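(* Assume $F\in\mathscr{S}_2$. Then for every fixed $\varepsilon>0$ there exist constants $A,K>0$, independent of $n$, such that for all $n\ge 2$, $$\sup_{x\ge A}\left|\frac{\overline{F^{n*}}(x)-n\overline{F}(x)}{F(x,x+1]}\right|\le K(1+\varepsilon)^n .$$
   Context: For a distribution $F$ on $[0,\infty)$: $\overline{F}(x)=1-F(x)$, $F(a,b]=F(b)-F(a)$, and $F^{n*}=F^{*n}$ is the $n$-fold convolution of $F$. For $t\in(0,\infty)$ put $\Delta(t)=(0,t]$ and $F(x+\Delta(t))=F(x,x+t]$. $a(x)\sim b(x)$ means $\lim_{x\to\infty}a(x)/b(x)=1$. $F\in\mathscr{L}_{\Delta(t)}$ (local long-tailed) if $F(x+y+\Delta(t))\sim F(x+\Delta(t))$ as $x\to\infty$, uniformly in $y\in[0,1]$. $F\in\mathscr{S}_{\Delta(t)}$ (local subexponential) if $F\in\mathscr{L}_{\Delta(t)}$ and $F^{*2}(x+\Delta(t))\sim 2F(x+\Delta(t))$ as $x\to\infty$. $F\in\mathscr{S}_2$ (second order subexponential) if $F$ is a distribution on $[0,\infty)$ with finite mean $\mu$, $F\in\mathscr{S}_{\Delta(t)}$ for all $t\in(0,\infty)$, and $\overline{F^{2*}}(x)-2\overline{F}(x)\sim 2\mu F(x,x+1]$ as $x\to\infty$. *)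

(* Defs.v *)
From HB Require Import structures.
From mathcomp Require Import all_boot all_order all_algebra.
From mathcomp Require Import all_classical all_reals all_analysis.
From mathcomp Require Import measurable_realfun.

Set Implicit Arguments.
Unset Strict Implicit.
Unset Printing Implicit Defensive.

Import Order.TTheory GRing.Theory Num.Theory.
Import numFieldNormedType.Exports.

Local Open Scope classical_set_scope.
Local Open Scope ring_scope.

(* Distributions are probability measures on the Borel sets of R. *)
Notation distr R := (probability (measurableTypeR R) R).

Section distributions.
Context {R : realType}.
Implicit Types F G : distr R.

Definition supported_nonneg F := F `]-oo, (0 : R)[%classic = 0%E.

Definition df F (x : R) : R := fine (F `]-oo, x]%classic).

Definition tail F (x : R) : R := 1 - df F x.

Definition incr F (a b : R) : R := df F b - df F a.

Definition sum2 (z : measurableTypeR R * measurableTypeR R) :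
  measurableTypeR R := z.1 + z.2.

Lemma measurable_sum2 : measurable_fun setT sum2.
Proof. by apply: measurable_funD; [exact: measurable_fst | exact: measurable_snd]. Qed.

HB.instance Definition _ := isMeasurableFun.Build _ _ _ _ sum2 measurable_sum2.

(* The law of X + Y for X, Y independent with laws F, G. *)
Definition convolution F G : distr R := distribution (F \x G)%E sum2.

(* By [iterop], the first power is F itself; the zeroth is the unit mass at 0. *)
Definition conv_pow F (n : nat) : distr R :=
  iterop n convolution F (dirac (0 : measurableTypeR R)).

(* Since x / 0 = 0, convergence to 1 forces b to be eventually nonzero. *)
Definition asymp_eq (a b : R -> R) := a x / b x @[x --> +oo] --> (1 : R).

Definition local_long_tailed (t : R) F :=
  {uniform `[0 : R, 1],
    (fun x y => incr F (x + y) (x + y + t) / incr F x (x + t)) @ +oo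
      --> cst (1 : R)}.

Definition local_subexponential (t : R) F :=
  local_long_tailed t F /\
  asymp_eq (fun x => incr (conv_pow F 2) x (x + t))
           (fun x => 2 * incr F x (x + t)).

Definition has_finite_mean F := F.-integrable setT (EFin : R -> \bar R).

Definition mean F : R := fine 'E_F[(id : R -> R)].

Definition second_order_subexponential F :=
  [/\ supported_nonneg F,
      has_finite_mean F,
      forall t : R, 0 < t -> local_subexponential t F &
      asymp_eq (fun x => tail (conv_pow F 2) x - 2 * tail F x)
               (fun x => 2 * mean F * incr F x (x + 1))].

End distributions.

(* Main.v *)
From HB Require Import structures.
Require Import Defs.
From mathcomp Require Import all_boot all_order all_algebra.
From mathcomp Require Import all_classical all_reals all_analysis.
From mathcomp Require Import measurable_realfun ring lra.

(** Write G_n(x) for the defect tail F^n* (x) - n tail F (x), and f(x) for F(x, x + 1].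
    Conditioning on the first summand gives, for x >= 0,
      G_(n+1)(x) = int_[0,x] G_n(x - y) F(dy) + n G_2(x)
    ([defect_recursion]), and |G_2| <= D f by second order subexponentiality. If
    |G_n| <= a f beyond A, then the integral is split at x - A.
    - For y <= x - A the integrand is at most a f(x - y), and the integral of f(x - y)
      over this range is at most (1 + eps/2) f(x) once A is large
      ([truncated_conv_le]). This is where local subexponentiality enters: the range
      where the first summand is small and the one where the second is small carry mass
      about f(x) each, out of a total of about 2 f(x).
    - For x - A < y <= x only |G_n| <= n is available, but the range has mass at most
      C f(x), because f varies slowly ([incr_window_le]).
    Hence a can be replaced by (1 + eps/2) a + n (C + D). Starting from G_1 = 0, the
    sequence K (1 + eps)^n satisfies these inequalities for large K, the linear term
    being absorbed by the gap between 1 + eps/2 and 1 + eps ([geometric_majorant]). *)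

Import Order.TTheory GRing.Theory Num.Theory.
Import numFieldNormedType.Exports.

Local Open Scope classical_set_scope.
Local Open Scope ring_scope.

Section second_order.
Context {R : realType}.
Implicit Types F G : distr R.

(** * Distribution functions and tails *)

Lemma bounded_measurable_integrable F (D : set R) (h : R -> R) (M : R) :
  measurable D -> measurable_fun setT h -> (forall y, `|h y| <= M) ->
  F.-integrable D (EFin \o h).
Proof.
move=> mD mh hM; apply: measurable_bounded_integrable => //.
- by rewrite (le_lt_trans (probability_le1 F _)) ?ltry.
- exact: measurable_funTS.
- exists M; split; first exact: num_real.
  by move=> N MN y _ /=; rewrite (le_trans (hM y)) ?ltW.
Qed.

Lemma integrable_scale F (a : R) (h : R -> R) :
  F.-integrable setT (EFin \o h) -> F.-integrable setT (EFin \o (fun y : R => a * h y)).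
Proof. exact: (integrableZl measurableT). Qed.

Lemma df_EFin F x : (df F x)%:E = F `]-oo, x]%classic.
Proof. by rewrite /df fineK// fin_num_measure. Qed.

Lemma tail_EFin F x : (tail F x)%:E = F `]x, +oo[%classic.
Proof.
rewrite /tail EFinB df_EFin -probability_setC//; congr (F _).
by rewrite setCitvl.
Qed.

Lemma df_mono F a b : a <= b -> df F a <= df F b.
Proof.
move=> ab; rewrite -lee_fin !df_EFin le_measure ?inE//.
by apply: subset_itvl; rewrite bnd_simp.
Qed.

Lemma df_ge0 F x : 0 <= df F x.
Proof. by rewrite -lee_fin df_EFin. Qed.

Lemma df_le1 F x : df F x <= 1.
Proof. by rewrite -lee_fin df_EFin probability_le1. Qed.

Lemma tail_ge0 F x : 0 <= tail F x. Proof. by rewrite subr_ge0 df_le1. Qed.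

Lemma tail_le1 F x : tail F x <= 1. Proof. by rewrite gerBl df_ge0. Qed.

Lemma incr_EFin F a b : a <= b -> (incr F a b)%:E = F `]a, b]%classic.
Proof.
move=> ab; rewrite /incr EFinB !df_EFin.
have -> : `]a, b]%classic = `]-oo, b]%classic `\` `]-oo, a]%classic :> set R.
  apply/seteqP; split => y /=; rewrite !in_itv/=.
    by move=> /andP[ay ->]; split => //; apply/negP; rewrite -ltNge.
  by move=> [-> /negP]; rewrite -ltNge andbT.
rewrite measureD//; last by rewrite (le_lt_trans (probability_le1 F _)) ?ltry.
congr (_ - F _)%E.
rewrite setIidr//; by apply: subset_itvl; rewrite bnd_simp.
Qed.

Lemma incr_ge0 F a b : a <= b -> 0 <= incr F a b.
Proof. by move=> ab; rewrite subr_ge0 df_mono. Qed.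

Lemma near_pinftyP (P : R -> Prop) :
  (\forall x \near +oo, P x) -> exists2 B : R, 0 < B & forall x, B <= x -> P x.
Proof.
move=> [B [_ hB]]; exists (`|B| + 1); first by rewrite ltr_wpDl.
by move=> x hx; apply: hB; rewrite (lt_le_trans _ hx)// ltr_pwDr// ler_norm.
Qed.

(** The identity as a random variable; its law under F is F itself. *)
Let idTR : measurableTypeR R -> R := idfun.

#[local] HB.instance Definition _ :=
  @isMeasurableFun.Build _ _ _ _ idTR (@measurable_id _ _ setT).

Lemma df_near1 F (e : R) : 0 < e -> exists2 c : R, 0 < c & 1 - e <= df F c.
Proof.
move=> e0.
have h : df F x @[x --> +oo] --> (1 : R).
  exact/fine_cvg/(cvg_cdfy1 (idTR : {RV F >-> R})).
have : \forall x \near +oo, `|1 - df F x| < e by move/cvgrPdist_lt : h => /(_ e e0).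
move=> /near_pinftyP[B B0 /(_ B (lexx B))]; rewrite ltr_norml => /andP[_ hB].
by exists B => //; lra.
Qed.

Lemma measurable_df F : measurable_fun setT (df F : R -> R).
Proof. by apply: nondecreasing_measurable => // a b; exact: df_mono. Qed.

Lemma measurable_df_sub F a : measurable_fun setT (fun y : R => df F (a - y)).
Proof.
apply: (measurableT_comp (measurable_df F)) => //; exact: measurable_funB.
Qed.

Lemma measurable_tail_sub F a : measurable_fun setT (fun y : R => tail F (a - y)).
Proof. apply: measurable_funB => //; exact: measurable_df_sub. Qed.

Lemma tail_Rintegral F x : tail F x = \int[F]_y \1_(`]x, +oo[%classic : set R) y.
Proof.
apply: EFin_inj; rewrite tail_EFin /Rintegral integral_indic// setIT fineK//.
exact: fin_num_measure.
Qed.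

Lemma supported_nonneg_tail F x : supported_nonneg F -> x < 0 -> tail F x = 1.
Proof.
move=> F0 x0; rewrite /tail -[RHS]subr0; congr (_ - _); apply: EFin_inj.
rewrite df_EFin; apply/eqP; rewrite eq_le measure_ge0 andbT -[leRHS]F0.
by rewrite le_measure ?inE//; apply: subset_itvl; rewrite bnd_simp.
Qed.

(** * Convolutions of distributions *)

(** Conditioning on the first summand: P(X + Y > x) is the mean of P(Y > x - X). *)
Lemma tail_convolution F G x :
  tail (convolution F G) x = \int[F]_y tail G (x - y).
Proof.
apply: EFin_inj; rewrite tail_EFin /Rintegral.
have -> : convolution F G `]x, +oo[%classic = (\int[F]_y (tail G (x - y))%:E)%E.
  rewrite /convolution/= /distribution /pushforward /product_measure1/=.
  apply: eq_integral => y _; rewrite tail_EFin /=; congr (G _).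
  apply/seteqP; split => z; rewrite /xsection /sum2/= ?in_setE/= !in_itv/= !andbT; lra.
rewrite fineK//.
apply: integrable_fin_num => //.
apply: (@bounded_measurable_integrable _ _ _ 1) => //; first exact: measurable_tail_sub.
by move=> y; rewrite ger0_norm ?tail_ge0 ?tail_le1.
Qed.

Lemma supported_nonneg_convolution F G : supported_nonneg F ->
  supported_nonneg G -> supported_nonneg (convolution F G).
Proof.
move=> F0 G0; rewrite /supported_nonneg.
pose N := `]-oo, (0 : R)[%classic : set (measurableTypeR R).
pose C := ((N `*` setT) `|` (setT `*` N)).
have mN : measurable N by exact: measurable_itv.
have mS : measurable (sum2 @^-1` N).
  by rewrite -[X in measurable X]setTI; exact: measurable_sum2.
have mX (A B : set (measurableTypeR R)) : measurable A -> measurable B ->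
   measurable (A `*` B) by exact: measurableX.
apply/eqP; rewrite eq_le measure_ge0 andbT.
rewrite [leLHS](_ : _ = (F \x G)%E (sum2 @^-1` N))//.
apply: (@le_trans _ _ ((F \x G)%E C)).
  rewrite le_measure ?inE//; first by apply: measurableU; apply: mX.
  move=> [y z]; rewrite /N /C /sum2/= !in_itv/= => yz0.
  have [y0|y0] := ltP y 0; first by left.
  right; split => //; rewrite /N/= in_itv/=; lra.
apply: le_trans (measureU2 _ _ _) _; [exact: mX|exact: mX|].
rewrite [X in (X + _)%E](product_measure1E F G mN measurableT).
rewrite [X in (_ + X)%E](product_measure1E F G measurableT mN).
by rewrite [X in (X * _ + _)%E]F0 [X in (_ + _ * X)%E]G0 mul0e mule0 adde0.
Qed.

Lemma conv_powS F n : conv_pow F n.+2 = convolution F (conv_pow F n.+1).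
Proof. by []. Qed.

Lemma supported_nonneg_conv_pow F n : supported_nonneg F ->
  supported_nonneg (conv_pow F n.+1).
Proof. by move=> F0; elim: n => // n IH; exact: supported_nonneg_convolution. Qed.

(** * Local mass of the convolution square, truncated in one variable *)

(** By [truncated_conv_EFin], the probability that X + Y lies in ]x, x + 1] and
    X <= c, for X, Y independent with law F. *)
Definition truncated_conv F (c x : R) :=
  \int[F]_(y in `]-oo, c]) incr F (x - y) (x - y + 1).

Definition conv_event (x : R) : set (measurableTypeR R * measurableTypeR R) :=
  [set z | x < z.1 + z.2 <= x + 1].

Lemma measurable_conv_event x : measurable (conv_event x).
Proof.
rewrite (_ : conv_event x = sum2 @^-1` `]x, x + 1]%classic); last first.
  by apply/seteqP; split => z; rewrite /conv_event /sum2/= in_itv.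
rewrite -[X in measurable X]setTI; apply: measurable_sum2 => //.
Qed.

Lemma measurable_fst_le (c : R) : measurable
  [set z : measurableTypeR R * measurableTypeR R | (z.1 : R) <= c].
Proof.
have h := @measurable_fst _ _ (measurableTypeR R) (measurableTypeR R).
rewrite (_ : [set z | _] = fst @^-1` `]-oo, c]%classic); last first.
  by apply/seteqP; split => z; rewrite /= in_itv.
rewrite -[X in measurable X]setTI; apply: h => //.
Qed.

Lemma measurable_snd_le (c : R) : measurable
  [set z : measurableTypeR R * measurableTypeR R | (z.2 : R) <= c].
Proof.
have h := @measurable_snd _ _ (measurableTypeR R) (measurableTypeR R).
rewrite (_ : [set z | _] = snd @^-1` `]-oo, c]%classic); last first.
  by apply/seteqP; split => z; rewrite /= in_itv.
rewrite -[X in measurable X]setTI; apply: h => //.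
Qed.

Lemma incr_sub_integrable F (D : set R) x : measurable D ->
  F.-integrable D (EFin \o (fun y : R => incr F (x - y) (x - y + 1))).
Proof.
move=> mD; apply: (@bounded_measurable_integrable _ _ _ 1) => //.
- apply: measurable_funB; last exact: measurable_df_sub.
  under eq_fun do rewrite addrAC.
  exact: measurable_df_sub.
- move=> y; rewrite ger0_norm ?incr_ge0 ?lerDl// /incr.
  by have := df_ge0 F (x-y); have := df_le1 F (x-y + 1); lra.
Qed.

Lemma truncated_conv_EFin F c x : (truncated_conv F c x)%:E =
  (F \x F)%E (conv_event x `&` [set z | z.1 <= c]).
Proof.
rewrite /truncated_conv /Rintegral fineK; last first.
  by apply: integrable_fin_num => //; exact: incr_sub_integrable.
rewrite integral_mkcond /product_measure1; apply: eq_integral => y _ /=.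
rewrite patchE; have [yc|yc] := leP y c.
  rewrite mem_set ?in_itv//= incr_EFin ?lerDl//; congr (F _).
  apply/seteqP; split => z; rewrite /xsection /conv_event/= ?in_setE/= !in_itv/=; lra.
rewrite memNset ?in_itv/=; last by apply/negP; rewrite -ltNge.
rewrite (_ : xsection _ _ = set0) ?measure0//.
apply/seteqP; split => z//; rewrite /xsection /conv_event/= ?in_setE/= ; lra.
Qed.

Lemma incr_convolution_EFin F x :
  (incr (convolution F F) x (x + 1))%:E = (F \x F)%E (conv_event x).
Proof.
by rewrite incr_EFin ?lerDl//.
Qed.

(** X and Y are exchangeable; formally, this is the uniqueness of the product measure,
    applied to the two orders of integration. *)
Lemma conv_event_swap F c x :
  (F \x F)%E (conv_event x `&` [set z | z.1 <= c]) =
  (F \x F)%E (conv_event x `&` [set z | z.2 <= c]).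
Proof.
have mE2 : measurable (conv_event x `&`
    [set z : measurableTypeR R * measurableTypeR R | (z.2 : R) <= c]).
  by apply: measurableI; [exact: measurable_conv_event|exact: measurable_snd_le].
have FF (A B : set (measurableTypeR R)) : measurable A -> measurable B ->
    (F \x^ F)%E (A `*` B) = (F A * F B)%E.
  by move=> mA mB; rewrite product_measure2E.
rewrite [RHS](product_measure_unique FF mE2).
rewrite /product_measure1 /product_measure2; apply: eq_integral => y _ /=.
congr (F _); apply/seteqP; split => z;
  rewrite /xsection /ysection /conv_event/= ?in_setE/=; lra.
Qed.

(** On the event x < X + Y, the conditions X <= x - a and Y <= c exclude each other when
    c <= a, so the two truncations cover disjoint parts of the convolution. *)
Lemma truncated_convD_le F a c x : c <= a ->
  truncated_conv F (x - a) x + truncated_conv F c x <=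
  incr (convolution F F) x (x + 1).
Proof.
move=> ca; rewrite -lee_fin EFinD incr_convolution_EFin !truncated_conv_EFin.
rewrite [X in (_ + X)%E]conv_event_swap.
have mE := measurable_conv_event x.
have m1 := measurable_fst_le (x - a); have m2 := measurable_snd_le c.
have m3 := measurableI _ _ mE m1; have m4 := measurableI _ _ mE m2.
rewrite -measureU//; last first.
  apply/seteqP; split => // -[y z]; rewrite /conv_event/=; lra.
rewrite le_measure ?inE//; first exact: measurableU.
by move=> z [] [].
Qed.

(** F has no mass below 0, so [df F c] is the mass of [0, c], and negative y can only
    increase the right side. *)
Lemma truncated_conv_ge F c x m : supported_nonneg F -> 0 <= c -> 0 <= m ->
  (forall y, 0 <= y <= c -> m <= incr F (x - y) (x - y + 1)) ->
  m * df F c <= truncated_conv F c x.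
Proof.
move=> F0 c0 m0 hm.
have dfc : df F c <= fine (F `[0, c]%classic).
  rewrite -lee_fin df_EFin fineK ?fin_num_measure//.
  rewrite -[leRHS]add0e -[X in (X + _)%E]F0.
  apply: le_trans (measureU2 _ _ _) => //.
  rewrite le_measure ?inE//; first exact: measurableU.
  move=> y; rewrite /= !in_itv/= => yc.
  by have [y0|y0] := ltP y 0; [left|right].
apply: (@le_trans _ _ (m * fine (F `[0, c]%classic))); first exact: ler_wpM2l.
rewrite -Rintegral_cst//.
apply: (@le_trans _ _ (\int[F]_(y in `[0, c]) incr F (x - y) (x - y + 1))).
  apply: le_Rintegral => //.
  - by apply: (@bounded_measurable_integrable _ _ _ `|m|).
  - exact: incr_sub_integrable.
have fin (D : set R) : measurable D ->
    (\int[F]_(y in D) (incr F (x - y) (x - y + 1))%:E)%E \is a fin_num.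
  by move=> mD; apply: integrable_fin_num => //; exact: incr_sub_integrable.
rewrite -lee_fin /truncated_conv /Rintegral !fineK ?fin//.
apply: ge0_subset_integral => //.
- by apply: (measurable_int F); exact: incr_sub_integrable.
- by move=> y _; rewrite lee_fin incr_ge0// lerDl.
- by move=> y /=; rewrite !in_itv/= => /andP[].
Qed.

(** * Consequences of long-tailedness *)

Lemma asymp_eq_near (a b : R -> R) (e : R) : asymp_eq a b -> 0 < e -> e < 1 ->
  exists2 B : R, 0 < B & forall x, B <= x -> b x != 0 /\ `|a x| <= (1 + e) * `|b x|.
Proof.
move=> ab e0 e1; apply: near_pinftyP.
move/cvgrPdist_lt : ab => /(_ e e0); apply: filterS => x hx.
have b0 : b x != 0.
  by apply/eqP => bx0; move: hx; rewrite bx0 invr0 mulr0 subr0 normr1; lra.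
split => //; rewrite -ler_pdivrMr ?normr_gt0// -normf_div.
by move: hx; rewrite ltr_norml ler_norml; lra.
Qed.

(** The quotient in the convolution condition tends to 1, whereas a quotient by 0
    is 0. *)
Lemma incr_unit_gt0 F : local_subexponential 1 F ->
  exists2 B : R, 0 < B & forall x, B <= x -> 0 < incr F x (x + 1).
Proof.
move=> [_ h2]; have [B B0 hB] := asymp_eq_near _ _ (2^-1) h2 ltac:(lra) ltac:(lra).
exists B => // x /hB[+ _]; rewrite mulf_eq0 negb_or => /andP[_ f0].
by rewrite lt_def f0 incr_ge0// lerDl.
Qed.

(** A quantitative form of long-tailedness: beyond B, a shift by at most one changes f
    by a factor between r and 1/r. *)
Definition unit_shift_bounded (r B : R) (f : R -> R) :=
  forall x y : R, B <= x -> 0 <= y <= 1 -> r * f (x + y) <= f x /\ r * f x <= f (x + y).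

(** A shift by s in [0, k] is k successive shifts by s/k, each of length at most one. *)
Lemma shift_bounded (r B : R) (f : R -> R) (k : nat) : 0 < r ->
  unit_shift_bounded r B f -> forall x s : R, B <= x -> 0 <= s <= k%:R ->
  r ^+ k * f (x + s) <= f x /\ r ^+ k * f x <= f (x + s).
Proof.
move=> r0 hf; elim: k => [|k IH] x s Bx /andP[s0 sk].
  by rewrite (_ : s = 0) ?addr0 ?expr0 ?mul1r//; apply/eqP; rewrite eq_le s0 sk.
pose y := s / k.+1%:R; have k1 : 0 < k.+1%:R :> R by rewrite ltr0n.
have y0 : 0 <= y by rewrite divr_ge0// ltW.
have y1 : y <= 1 by rewrite ler_pdivrMr// mul1r.
have sE : s = y * k%:R + y by rewrite -[X in _ + X]mulr1 -mulrDr natr1 divfK// gt_eqF.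
have yk0 : 0 <= y * k%:R by rewrite mulr_ge0.
have yk : 0 <= y * k%:R <= k%:R by rewrite yk0/= ler_piMl.
have [h1 h2] := IH x _ Bx yk.
have [|h3 h4] := hf (x + y * k%:R) y _ (introT andP (conj y0 y1)).
  by rewrite (le_trans Bx)// lerDl.
rewrite sE addrA exprSr; split.
  by rewrite (le_trans _ h1)// -mulrA ler_wpM2l// exprn_ge0// ltW.
by rewrite (le_trans _ h4)// -mulrA mulrCA ler_wpM2l// ltW.
Qed.

(** With f x for [incr F x (x + 1)], long-tailedness puts f (x + y) / f x between r and
    2 - r, and r (2 - r) <= 1 turns the upper bound 2 - r into 1/r. *)
Lemma local_long_tailed_shift_bounded F (r : R) : local_long_tailed 1 F ->
  (exists2 B : R, 0 < B & forall x, B <= x -> 0 < incr F x (x + 1)) ->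
  0 < r -> r < 1 ->
  exists2 B : R, 0 < B & unit_shift_bounded r B (fun x => incr F x (x + 1)).
Proof.
move=> hF [B0 B00 f0] r0 r1.
have h : \forall x \near +oo, forall y : R, 0 <= y <= 1 ->
    `|1 - incr F (x + y) (x + y + 1) / incr F x (x + 1)| < 1 - r.
  apply: (hF [set g : R -> R | forall y, 0 <= y <= 1 -> `|1 - g y| < 1 - r]).
  apply/uniform_nbhs.
  exists [set z : R * R | ball z.1 (1 - r) z.2]; split.
    by rewrite -entourage_ballE; exists (1 - r) => //=; rewrite subr_gt0.
  by move=> g /= hg y y01; apply: hg; rewrite /= in_itv.
have [B1 B10 h1] := near_pinftyP _ h.
exists (Num.max B0 B1); first by rewrite lt_max B00.
move=> x y; rewrite ge_max => /andP[Bx0 Bx1] y01.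
have fx := f0 _ Bx0; move: (h1 x Bx1 y y01).
set v := incr F (x + y) _; set u := incr F x _ in fx *.
rewrite ltr_norml => /andP[ha hb].
have -> : v = v / u * u by rewrite divfK// gt_eqF.
set w := v / u in ha hb *.
have wu : w * u <= (2 - r) * u by rewrite ler_pM2r//; lra.
have ru : 0 <= (1 - r) ^+ 2 * u by rewrite mulr_ge0 ?sqr_ge0// ltW.
split; last by rewrite ler_pM2r//; lra.
have := ler_wpM2l (ltW r0) wu; nra.
Qed.

(** Far out, a window of length A is covered by boundedly many unit windows, all
    comparable to ]x, x + 1]. For x in [A, 2A], where x - A may lie below A, instead
    F(x, x + 1] is bounded below by a multiple of F(A, A + 1], and 1 bounds the left
    side. *)
Lemma incr_window_le F (A : R) : 0 < A ->
  unit_shift_bounded 2^-1 A (fun x => incr F x (x + 1)) ->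
  0 < incr F A (A + 1) ->
  exists2 C : R, 0 < C & forall x, A <= x ->
    incr F (x - A) x <= C * incr F x (x + 1).
Proof.
move=> A0 hA fA.
pose k := (Num.truncn A).+1; have Ak : A <= k%:R by rewrite ltW// truncnS_gt.
have i2 : 0 < 2^-1 :> R by [].
have sb := shift_bounded _ _ _ k i2 hA.
set q : R := 2 ^+ k; have q0 : 0 < q by rewrite exprn_gt0.
have qE : 2^-1 ^+ k = q^-1 by rewrite exprVn.
rewrite qE in sb.
have Ak' : 0 <= A <= k%:R by rewrite ltW.
pose f x := incr F x (x + 1).
have f0 x : 0 <= f x by rewrite incr_ge0 ?lerDl.
exists (q / f A + k%:R * q ^+ 2).
  by rewrite ltr_wpDr ?divr_gt0// mulr_ge0// exprn_ge0// ltW.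
move=> x Ax; rewrite -/(f x) mulrDl; have [x2|x2] := leP x (2 * A).
  apply: (@le_trans _ _ (q / f A * f x)); last first.
    by rewrite lerDl mulr_ge0// mulr_ge0// exprn_ge0// ltW.
  apply: (@le_trans _ _ 1).
    by rewrite /incr; have := df_ge0 F (x - A); have := df_le1 F x; lra.
  have [|_] := sb A (x - A) (lexx A); first by apply/andP; split; lra.
  rewrite subrKC -/(f A) -/(f x) => h.
  by rewrite mulrAC ler_pdivlMr// mul1r -ler_pdivrMl// .
apply: (@le_trans _ _ (k%:R * q ^+ 2 * f x)); last first.
  by rewrite lerDr mulr_ge0// divr_ge0// ltW.
set u := x - A; have Au : A <= u by rewrite /u; lra.
have fux : f u <= q * f x.
  by have [_] := sb u A Au Ak'; rewrite (_ : u + A = x) ?subrK// ler_pdivrMl.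
apply: (@le_trans _ _ (incr F u (u + k%:R))).
  by rewrite /incr lerB// df_mono// /u; lra.
have : forall j, (j <= k)%N -> incr F u (u + j%:R) <= j%:R * (q * f u).
  elim=> [|j IH] jk; first by rewrite addr0 mul0r /incr subrr.
  have h1 := IH (ltnW jk).
  have jk' : 0 <= (j%:R : R) <= k%:R by rewrite ler0n ler_nat ltnW.
  have [+ _] := sb u j%:R Au jk'; rewrite ler_pdivrMl// -/(f u) => h2.
  move: h1 h2; rewrite -natr1 addrA /incr mulrDl mul1r; lra.
move=> /(_ k (leqnn k)) /le_trans; apply.
by rewrite -mulrA ler_wpM2l// expr2 -mulrA ler_wpM2l// ltW.
Qed.

(** * Mass of the convolution square away from the endpoint *)

Lemma bernoulli_le (e : R) k : 0 <= e -> e <= 1 -> 1 - k%:R * e <= (1 - e) ^+ k.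
Proof.
move=> e0 e1; elim: k => [|k IH]; first by rewrite mul0r subr0.
have k0 : 0 <= k%:R :> R by [].
by rewrite exprS -natr1; nra.
Qed.

(** Two independent copies reach ]x, x + 1] with probability about 2 F(x, x + 1]. By
    long-tailedness, the part where one of them stays below a large constant c carries
    nearly F(x, x + 1]; by [truncated_convD_le], at most about F(x, x + 1] is left for
    the part where the other one does not come within A >= c of x. *)
Lemma truncated_conv_le F (d : R) : supported_nonneg F ->
  local_subexponential 1 F -> 0 < d ->
  exists2 A0 : R, 0 < A0 & forall A x, A0 <= A -> A <= x ->
    truncated_conv F (x - A) x <= (1 + d) * incr F x (x + 1).
Proof.
move=> F0 hF d0.
(* The bounds 2 (1 + e) f and (1 - e)^2 f obtained below differ by at most (1 + 4 e) f. *)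
pose e : R := Num.min d 1 / 4.
have e0 : 0 < e by rewrite divr_gt0// lt_min d0/=.
have e1 : e <= 4^-1 by rewrite /e ler_pdivrMr// mulVf// ge_min lexx orbT.
have ed : 4 * e <= d by rewrite /e mulrC divfK// ge_min lexx.
clearbody e; have [c c0 dfc] := df_near1 F e e0.
pose k := (Num.truncn c).+1; have ck : c <= k%:R by rewrite ltW// truncnS_gt.
have k1 : 1 <= k.+1%:R :> R by rewrite ler1n.
(* By Bernoulli's inequality, k shifts at the rate 1 - t cost at most a factor 1 - e. *)
have [t [t0 te kt]] : exists t : R, [/\ 0 < t, t <= e & k%:R * t <= e].
  exists (e / k.+1%:R); split; first by rewrite divr_gt0// ltr0n.
  - by rewrite ler_pdivrMr ?ltr0n// ler_peMr// ltW.
  - by rewrite mulrCA ler_piMr ?(ltW e0)// ler_pdivrMr ?ltr0n// mul1r ler_nat.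
pose r : R := 1 - t.
have r0 : 0 < r by rewrite /r; lra.
have r1 : r < 1 by rewrite /r; lra.
have rk : 1 - e <= r ^+ k.
  by apply: le_trans (bernoulli_le _ _ (ltW t0) _); lra.
have [B B0 hB] := local_long_tailed_shift_bounded F r hF.1 (incr_unit_gt0 F hF) r0 r1.
have [B1 B10 hB1] := asymp_eq_near _ _ e hF.2 e0 ltac:(lra).
exists (Num.max (B + c) B1); first by rewrite lt_max B10 orbT.
move=> A x; rewrite ge_max => /andP[BA B1A] Ax.
set f := incr F x (x + 1).
have f0 : 0 <= f by rewrite incr_ge0 ?lerDl.
have h2 : incr (convolution F F) x (x + 1) <= (1 + e) * (2 * f).
  have [|_] := hB1 x; first by lra.
  by rewrite !ger0_norm// ?mulr_ge0// incr_ge0 ?lerDl.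
have h1 : truncated_conv F (x - A) x + truncated_conv F c x <=
  incr (convolution F F) x (x + 1) by apply: truncated_convD_le; lra.
have h3 : r ^+ k * f * df F c <= truncated_conv F c x.
  apply: truncated_conv_ge => //; [exact: ltW|by rewrite mulr_ge0// exprn_ge0// ltW|].
  move=> y /andP[y0 yc].
  have [||] := shift_bounded _ _ _ k r0 hB (x - y) y; [by lra|by rewrite y0/=; lra|].
  by rewrite subrK.
have h4 : (1 - 2 * e) * f <= r ^+ k * f * df F c.
  rewrite mulrAC ler_wpM2r//.
  apply: (@le_trans _ _ ((1 - e) * (1 - e))); first by nra.
  by apply: ler_pM => //; lra.
nra.
Qed.

(** * The defect of the tail of a convolution power *)

Definition defect F n x := tail (conv_pow F n) x - n%:R * tail F x.

Lemma defect_norm_le F n x : (0 < n)%N -> `|defect F n x| <= n%:R.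
Proof.
move=> n0; have n1 : 1 <= n%:R :> R by rewrite ler1n.
have [] := (tail_ge0 F x, tail_le1 F x).
have [] := (tail_ge0 (conv_pow F n) x, tail_le1 (conv_pow F n) x).
by rewrite /defect ler_norml; nra.
Qed.

(** The indicator makes the integrand vanish for y > x when F lives on [0, oo), since
    both tails at x - y are then 1 and the defect is -n. Its integral n F(x, oo) comes
    from writing n + 2 as 2 (n + 1) - n. *)
Lemma defect_recursion F n x :
  defect F n.+2 x = \int[F]_y (defect F n.+1 (x - y) +
     n%:R * \1_(`]x, +oo[%classic : set R) y) + n.+1%:R * defect F 2 x.
Proof.
have i1 G : F.-integrable setT (EFin \o (fun y : R => tail G (x - y))).
  apply: (@bounded_measurable_integrable _ _ _ 1) => //.
    exact: measurable_tail_sub.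
  by move=> y; rewrite ger0_norm ?tail_ge0 ?tail_le1.
have i2 : F.-integrable setT (EFin \o (\1_(`]x, +oo[%classic : set R) : R -> R)).
  apply: (@bounded_measurable_integrable _ _ _ 1) => //.
  by move=> y; rewrite indicE; case: (_ \in _); rewrite ?normr1 ?normr0.
have iD := integrableB measurableT (i1 (conv_pow F n.+1))
  (integrable_scale F n.+1%:R _ (i1 F)).
rewrite RintegralD//; last exact: integrable_scale.
rewrite RintegralB//; last exact: integrable_scale.
rewrite !RintegralZl// -!tail_convolution -tail_Rintegral /defect !conv_powS /=.
by rewrite -!natr1; ring.
Qed.

(** The integral of [defect_recursion] is split at x - A and x: the hypothesis bounds the
    defect at x - y for y <= x - A, the trivial bound n + 1 applies on ]x - A, x], and
    the integrand vanishes for y > x. *)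
Lemma defect_step F n (A x a : R) : supported_nonneg F -> 0 <= a -> 0 <= A ->
  (forall u, A <= u -> `|defect F n.+1 u| <= a * incr F u (u + 1)) ->
  `|defect F n.+2 x| <= a * truncated_conv F (x - A) x
     + n.+1%:R * incr F (x - A) x + n.+1%:R * `|defect F 2 x|.
Proof.
move=> F0 a0 A0 ha; rewrite defect_recursion.
apply: (le_trans (ler_normD _ _)); rewrite normrM ger0_norm// lerD2r.
set H := fun y => _.
have mD : measurable_fun setT (fun y : R => defect F n.+1 (x - y)).
  apply: measurable_funB; first exact: measurable_tail_sub.
  by apply: measurable_funM => //; exact: measurable_tail_sub.
have iH : F.-integrable setT (EFin \o H).
  apply: (@bounded_measurable_integrable _ _ _ (n.+1%:R + n%:R)) => //.
    by apply: measurable_funD => //; apply: measurable_funM.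
  move=> y; apply: (le_trans (ler_normD _ _)); rewrite lerD ?defect_norm_le//.
  by rewrite indicE; case: (_ \in _); rewrite ?mulr1 ?mulr0 ?normr0// ger0_norm.
apply: (le_trans (le_normr_Rintegral _ _)) => //.
pose g y := incr F (x - y) (x - y + 1).
pose D1 : set R := `]-oo, x - A]%classic; pose D2 : set R := `]x - A, x]%classic.
have ig : F.-integrable setT (EFin \o (g \_ D1)).
  have mD1 : measurable D1 by exact: measurable_itv.
  rewrite -restrict_EFin; apply: (iffLR
    (@integrable_mkcond _ (measurableTypeR R) R F D1 (EFin \o g) mD1)).
  exact: incr_sub_integrable.
have mD2 : measurable D2 by exact: measurable_itv.
have i2 : F.-integrable setT (EFin \o (\1_D2 : R -> R)).
  apply: (@bounded_measurable_integrable _ _ _ 1) => //.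
  by move=> y; rewrite indicE; case: (_ \in _); rewrite ?normr1 ?normr0.
have -> : a * truncated_conv F (x - A) x + n.+1%:R * incr F (x - A) x =
    \int[F]_y (a * (g \_ D1) y + n.+1%:R * \1_D2 y).
  rewrite RintegralD//; [|exact: integrable_scale|exact: integrable_scale].
  rewrite !RintegralZl// -Rintegral_mkcond; congr (_ + _ * _).
  apply: EFin_inj; rewrite incr_EFin ?gerBl// /Rintegral integral_indic// setIT.
  by rewrite fineK// fin_num_measure.
apply: le_Rintegral => //.
- exact: (integrable_norm iH).
- exact: integrableD (integrable_scale F a _ ig) (integrable_scale F n.+1%:R _ i2).
move=> y _; rewrite /H patchE !indicE /D1 /D2 !mem_setE !in_itv/= andbT.
have [yx|xy] := ltP x y.
  have -> : (y <= x - A) = false by lra.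
  rewrite andbF mulr1 !mulr0 addr0 /defect !supported_nonneg_tail//; [|lra| |lra].
    by rewrite -natr1 normr_le0; apply/eqP; ring.
  exact: supported_nonneg_conv_pow.
rewrite mulr0 addr0 andbT; have [yA|yA] := leP y (x - A).
  by rewrite mulr0 addr0 ha//; lra.
by rewrite mulr0 add0r mulr1 defect_norm_le.
Qed.

(** The gain 1 + e over 1 + e/2 leaves room K e/2 (1 + e)^(n+1), which for large K
    dominates the linear term by Bernoulli's inequality. *)
Lemma geometric_majorant (e b : R) : 0 < e -> 0 < b ->
  exists2 K : R, 0 < K & forall n : nat,
    (1 + e / 2) * (K * (1 + e) ^+ n.+1) + n.+1%:R * b <= K * (1 + e) ^+ n.+2.
Proof.
move=> e0 b0; exists (2 * b / e ^+ 2); first by rewrite divr_gt0 ?mulr_gt0// exprn_gt0.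
move=> n; set K := 2 * b / e ^+ 2.
have bern : n.+1%:R * e <= (1 + e) ^+ n.+1.
  elim: n => [|n IH]; first by rewrite expr1; lra.
  rewrite exprS -(natr1 n.+1) mulrDl mul1r [leRHS]mulrDl mul1r lerD//.
  by rewrite ler_peMr ?(ltW e0)// exprn_ege1//; lra.
have bE : b = K * e / 2 * e by rewrite /K; field; lra.
rewrite [(1 + e) ^+ n.+2]exprS.
have K0 : 0 <= K * e / 2 by rewrite /K !mulr_ge0// ?invr_ge0 ?exprn_ge0// ltW.
have := ler_wpM2l K0 bern; rewrite [X in _ + _ * X]bE; clearbody K; lra.
Qed.

End second_order.

Theorem proposition2 (R : realType) (F : distr R)
    (hF : second_order_subexponential F) (eps : R) (heps : 0 < eps) :
  exists A K : R,
    [/\ 0 < A, 0 < K,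
        forall x : R, A <= x -> 0 < incr F x (x + 1) &
        forall n : nat, (2 <= n)%N ->
          (ereal_sup [set (`| (tail (conv_pow F n) x - n%:R * tail F x)
                              / incr F x (x + 1) |)%:E | x in [set x : R | (A <= x)%R]]
           <= (K * (1 + eps) ^+ n)%:E)%E].
Proof.
have [F0 _ /(_ 1 ltr01) hF1 hF2] := hF.
have [B1 B10 f0] := incr_unit_gt0 F hF1.
have [B2 B20 f2] := local_long_tailed_shift_bounded F 2^-1 hF1.1
  (incr_unit_gt0 F hF1) ltac:(lra) ltac:(lra).
have eps2 : 0 < eps / 2 by lra.
have [B3 B30 f3] := truncated_conv_le F _ F0 hF1 eps2.
have [B4 B40 f4] := asymp_eq_near _ _ 2^-1 hF2 ltac:(lra) ltac:(lra).
pose A := B1 + B2 + B3 + B4; have A0 : 0 < A by rewrite /A; lra.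
have fA x : A <= x -> 0 < incr F x (x + 1).
  by move=> Ax; apply: f0; move: Ax; rewrite /A; lra.
have [|C C0 hC] := incr_window_le F A A0 _ (fA A (lexx A)).
  by move=> x y Ax; apply: f2; move: Ax; rewrite /A; lra.
(* For x >= B4 the relative error is at most 1/2, and (1 + 1/2) * 2 = 3. *)
pose D : R := 3 * `|mean F|.
have hD x : A <= x -> `|defect F 2 x| <= D * incr F x (x + 1).
  move=> Ax; have [|_] := f4 x; first by move: Ax; rewrite /A; lra.
  move/le_trans; apply; rewrite !normrM (ger0_norm (ltW (fA x Ax))) ger0_norm// /D.
  lra.
have D0 : 0 <= D by rewrite mulr_ge0.
have [K K0 hK] := geometric_majorant eps (C + D) heps ltac:(lra).
have e1 : 0 <= 1 + eps by lra.
have main n x : A <= x ->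
    `|defect F n.+1 x| <= K * (1 + eps) ^+ n.+1 * incr F x (x + 1).
  elim: n x => [|n IH] x Ax; have fx := fA x Ax.
    rewrite /defect /conv_pow/= mul1r subrr normr0 mulr_ge0 ?(ltW fx)//.
    by rewrite mulr_ge0 ?exprn_ge0// ltW.
  have a0 : 0 <= K * (1 + eps) ^+ n.+1 by rewrite mulr_ge0 ?exprn_ge0// ltW.
  apply: (le_trans (defect_step F n A x _ F0 a0 (ltW A0) IH)).
  have BA : B3 <= A by rewrite /A; lra.
  have h1 := ler_wpM2l a0 (f3 A x BA Ax).
  have n0 : 0 <= n.+1%:R :> R by [].
  have h2 := ler_wpM2l n0 (hC x Ax).
  have h3 := ler_wpM2l n0 (hD x Ax).
  have h4 := ler_wpM2r (ltW fx) (hK n).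
  apply: (le_trans _ h4); lra.
exists A, K; split => // -[|n]// n2.
apply: ge_ereal_sup => _ [x /= Ax <-]; rewrite lee_fin normrM normfV.
rewrite (gtr0_norm (fA x Ax)) ler_pdivrMr ?fA//; exact: main.
Qed.
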